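(* Let $r$ be the rank of the kernel $\mathcal K$ and $\pi$ the invariant distribution of $A$. For any $k\in\mathcal K$, $$\pi kk^{\top}=\frac1r\,u,$$ where $u$ is the all-ones row vector of length $n$.
   Context: The setting: a directed graph on the vertex set $\{1,\ldots,n\}$ in which each vertex has out-degree $d$, with adjacency matrix $\mathcal A$ such that $A=d^{-1}\mathcal A$ is irreducible and aperiodic; $\pi$ is the unique probability row vector with $\pi A=\pi$. $\mathcal A=C_1+\cdots+C_d$, where each $C_i$ is a binary stochastic matrix (a $0$-$1$ matrix with exactly one $1$ in each row). $\mathcal S$ is the finite semigroup generated by the $C_i$ under matrix multiplication, and $\mathcal K$ is its kernel (minimal ideal, consisting of the elements of minimal rank); $r$ is the common rank of the elements of $\mathcal K$. *)

(* Defs.v *)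
From mathcomp Require Import all_boot all_order all_algebra.
Set Implicit Arguments.
Unset Strict Implicit.
Unset Printing Implicit Defensive.
Import Order.TTheory GRing.Theory Num.Theory.
Local Open Scope ring_scope.

(* A directed graph on 'I_n is given by its adjacency matrix: G i j is the    *)
(* number of edges from i to j, so loops and parallel edges are allowed.      *)
Definition out_regular (n d : nat) (G : 'M[nat]_n) : Prop :=
  forall i, (\sum_j G i j)%N = d.

Definition adjacency (R : realFieldType) (n : nat) (G : 'M[nat]_n) : 'M[R]_n :=
  \matrix_(i, j) (G i j)%:R.

Definition irreducible_mx (R : realFieldType) (n : nat) (A : 'M[R]_n) : Prop :=
  forall i j, exists k : nat, (0 < k)%N /\ 0 < (A ^+ k) i j.

(* p is the gcd of the (possibly infinite) set of return times to i. *)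
Definition period_at (R : realFieldType) (n : nat) (A : 'M[R]_n) (i : 'I_n)
    (p : nat) : Prop :=
  forall g : nat,
    (forall k : nat, (0 < k)%N -> 0 < (A ^+ k) i i -> (g %| k)%N) <->
    (g %| p)%N.

Definition aperiodic_mx (R : realFieldType) (n : nat) (A : 'M[R]_n) : Prop :=
  forall i, period_at A i 1.

Definition invariant_distribution (R : realFieldType) (n : nat) (A : 'M[R]_n)
    (pi : 'rV[R]_n) : Prop :=
  [/\ forall j, 0 <= pi 0 j, \sum_j pi 0 j = 1 & pi *m A = pi].

Definition binary_stochastic (R : realFieldType) (n : nat) (M : 'M[R]_n) :
    Prop :=
  (forall i j, M i j = 0 \/ M i j = 1) /\
  (forall i, exists! j, M i j = 1).

Inductive semigroup_gen (R : realFieldType) (n d : nat)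
    (C : 'I_d -> 'M[R]_n) : 'M[R]_n -> Prop :=
| semigroup_gen_base i : semigroup_gen C (C i)
| semigroup_gen_mul X Y :
    semigroup_gen C X -> semigroup_gen C Y -> semigroup_gen C (X *m Y).

Section Ideals.
Variables (R : realFieldType) (n : nat).
Implicit Types S I K : 'M[R]_n -> Prop.

(* Nonempty two-sided ideals of the matrix semigroup S. *)
Definition semigroup_ideal S I : Prop :=
  [/\ exists X, I X,
      forall X, I X -> S X
    & forall X Y, S X -> I Y -> I (X *m Y) /\ I (Y *m X)].

Definition minimal_ideal S K : Prop :=
  semigroup_ideal S K /\
  (forall I, semigroup_ideal S I -> (forall X, I X -> K X) ->
    forall X, K X -> I X).

Definition common_rank K (r : nat) : Prop := forall X, K X -> \rank X = r.

End Ideals.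

(* The elements of a minimal ideal always have a common rank. *)
Lemma minimal_ideal_common_rank (R : realFieldType) (n d : nat)
    (C : 'I_d -> 'M[R]_n) (K : 'M[R]_n -> Prop) :
  minimal_ideal (semigroup_gen C) K -> exists r, common_rank K r.
Proof.
move=> [[[X0 KX0] KS Kid] Kmin].
have le_rank X Y : K X -> K Y -> (\rank Y <= \rank X)%N.
  move=> KX KY.
  suff /(_ Y KY)[] : forall Z, K Z -> K Z /\ (\rank Z <= \rank X)%N by [].
  apply: Kmin; last by move=> Z [].
  split; first by exists X.
    by move=> Z [/KS].
  move=> Z W SZ [KW leW]; have [ZW WZ] := Kid _ _ SZ KW.
  split; split=> //; apply: leq_trans leW; [exact: mxrankM_maxr|exact: mxrankM_maxl].
exists (\rank X0) => X KX; apply/eqP; rewrite eqn_leq.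
by rewrite !le_rank.
Qed.

(* Main.v *)
Require Import Defs.
From mathcomp Require Import all_boot all_order all_algebra.
Import Order.TTheory GRing.Theory Num.Theory.
Local Open Scope ring_scope.

Set Implicit Arguments.
Unset Strict Implicit.
Unset Printing Implicit Defensive.

(** For a map [f] of the vertices, entry [j] of [pi *m fun_mx f] is the
    [pi]-mass of the fibre of [f] over [j], and entry [x] of
    [pi *m fun_mx f *m (fun_mx f)^T] is the mass of the fibre containing [x].
    So the claim is that all the fibres of a map in the kernel have the same
    mass; as there are [r] of them, that mass is [1 / r].

    The argument is Friedman's.  Invariance of [pi] says that the mass of a set
    is the average of the masses of its preimages under the [d] generators.
    Fix a fibre [B0] of [k].  Among its preimages under words choose one, [B],
    of maximal mass: by averaging, every further preimage of [B] has the same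
    mass ([maximum_principle]).  Now take any fibre [F] of [k], the one over
    [j].  By irreducibility some word [w] leads from [j] into [B], so the
    preimage of [B] under [k] followed by [w] contains [F].  It is also a fibre
    of an element [k m k] of the kernel; that element has the same rank as [k]
    and factors through [k], so it has the same fibres, and the preimage is
    exactly [F].  Hence the mass of [F] is that of [B]. *)

(** * Maps as matrices *)

Section FunctionMatrix.

Variables (R : realFieldType) (n : nat).
Implicit Types f g : 'I_n -> 'I_n.

Definition fun_mx f : 'M[R]_n := rowsub f 1%:M.

Lemma fun_mxE f i j : fun_mx f i j = (f i == j)%:R.
Proof. by rewrite !mxE. Qed.

(** Matrices act on row vectors, so products compose from left to right. *)
Lemma fun_mxM f g : fun_mx f *m fun_mx g = fun_mx (g \o f).
Proof. by rewrite mul_rowsub_mx mul1mx -rowsub_comp. Qed.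

Lemma eq_fun_mx f g : f =1 g -> fun_mx f = fun_mx g.
Proof. by move=> fg; apply/matrixP=> i j; rewrite !fun_mxE fg. Qed.

Lemma mul_fun_mxE (p : 'rV[R]_n) f j :
  (p *m fun_mx f) 0 j = \sum_(i | f i == j) p 0 i.
Proof.
rewrite mxE [RHS]big_mkcond; apply: eq_bigr => i _.
by rewrite fun_mxE; case: eqP; rewrite ?mulr1 ?mulr0.
Qed.

Lemma mul_fun_mx_trE (v : 'rV[R]_n) f i :
  (v *m (fun_mx f)^T) 0 i = v 0 (f i).
Proof.
rewrite mxE (bigD1 (f i)) //= big1 ?addr0 => [|j /negPf jfi].
  by rewrite mxE fun_mxE eqxx mulr1.
by rewrite mxE fun_mxE eq_sym jfi mulr0.
Qed.

(** The rows of [fun_mx f] are the basis vectors indexed by the image of [f],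
    with repetitions. *)
Lemma rank_fun_mx f : \rank (fun_mx f) = #|f @: 'I_n|.
Proof.
pose s := @enum_val _ [in f @: 'I_n].
have f_image x : f x \in f @: 'I_n by exact: imset_f.
pose h x := enum_rank_in (f_image x) (f x).
have s_image i : exists x, s i == f x.
  by rewrite /s; have /imsetP[x _ ->] := enum_valP i; exists x.
pose t i := xchoose (s_image i).
have free_s : row_free (rowsub s (1%:M : 'M[R]_n)).
  apply/row_freeP; exists (rowsub s 1%:M)^T.
  apply/matrixP=> i j; rewrite mul_rowsub_mx mul1mx !mxE.
  by rewrite /s (inj_eq enum_val_inj) eq_sym.
rewrite -[RHS](eqP free_s) /fun_mx; apply: eqmx_rank; apply/andP; split.
  apply: (submx_rowsub h) => x /=.
  by rewrite /s enum_rankK_in.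
apply: (submx_rowsub t) => i /=.
by apply/eqP; exact: xchooseP (s_image i).
Qed.

Lemma binary_stochastic_fun_mx (M : 'M[R]_n) :
  binary_stochastic M -> exists f : {ffun 'I_n -> 'I_n}, M = fun_mx f.
Proof.
case=> M01 M1.
have [f fP] := fin_all_exists M1.
exists (finfun f); apply/matrixP=> i j; rewrite fun_mxE ffunE.
have [Mf funiq] := fP i; case: eqP => [<- // | fij].
by case: (M01 i j) => // /funiq.
Qed.

End FunctionMatrix.

(** As [f \o g] maps the image of [f], a finite set, into itself, it permutes
    that image as soon as it keeps its cardinality. *)
Lemma card_imset_return (T : finType) (f g : T -> T) :
    #|(f \o g \o f) @: T| = #|f @: T| ->
  (forall x y, f (g (f x)) = f (g (f y)) -> f x = f y) /\
  (forall x, exists y, f (g y) = f x).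
Proof.
move=> card_eq.
have imE : (f \o g \o f) @: T = (f \o g) @: (f @: T) by exact: imset_comp.
have sub : (f \o g \o f) @: T \subset f @: T.
  by apply/subsetP=> _ /imsetP[x _ ->]; apply: imset_f.
split=> [x y | x].
  have /imset_injP inj : #|(f \o g) @: (f @: T)| == #|f @: T|.
    by rewrite -imE card_eq.
  by apply: inj; apply: imset_f.
have : f x \in (f \o g \o f) @: T.
  have /eqP -> : (f \o g \o f) @: T == f @: T.
    by rewrite eqEcard sub card_eq leqnn.
  exact: imset_f.
by case/imsetP=> y _ ->; exists (f y).
Qed.

(** * A maximum principle *)

(** On the states reachable from [t0] choose one of maximal value.  Its value
    is the average of the values of its [d] successors, none of which is
    larger, so they are all equal to it; iterate. *)
Lemma maximum_principle (R : realFieldType) (T : finType) (d : nat)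
    (step : 'I_d -> T -> T) (phi : T -> R) (t0 : T) :
    (forall t, \sum_a phi (step a t) = d%:R * phi t) ->
  exists w0, forall w,
    phi (foldr step t0 (w ++ w0)) = phi (foldr step t0 w0).
Proof.
move=> harm; pose e : rel T := [rel t u | [exists a, u == step a t]].
have [t t0t tmax] := @arg_maxP _ _ T t0 (connect e t0) phi (connect0 _ _).
have [w0 tE] : exists w0, t = foldr step t0 w0.
  have [p] := connectP t0t; elim/last_ind: p t {t0t tmax} => [|p u IH] t /=.
    by move=> _ ->; exists [::].
  rewrite rcons_path last_rcons => /andP[/IH/(_ erefl)[w ->]].
  by case/existsP=> a /eqP -> ->; exists (a :: w).
exists w0 => w; rewrite -tE.
suff [] : connect e t0 (foldr step t0 (w ++ w0)) /\
          phi (foldr step t0 (w ++ w0)) = phi t by [].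
elim: w => [|a w [reach IH]] /=; first by rewrite -tE.
set u := foldr _ _ _ in reach IH *.
have reach_step b : connect e t0 (step b u).
  apply: connect_trans reach (connect1 _).
  by apply/existsP; exists b.
split=> //.
have gap0 : \sum_b (phi t - phi (step b u)) = 0.
  by rewrite sumrB harm IH sumr_const card_ord mulr_natl subrr.
have gap_ge0 b : true -> 0 <= phi t - phi (step b u).
  by move=> _; rewrite subr_ge0; apply: tmax.
by apply/esym/eqP; rewrite -subr_eq0 (psumr_eq0P gap_ge0 gap0).
Qed.

(** * Words in the generators *)

Section Words.

Variables (R : realFieldType) (n d : nat).
Variables (C : 'I_d -> 'M[R]_n) (c : 'I_d -> {ffun 'I_n -> 'I_n}).
Hypothesis CE : forall a, C a = fun_mx R (c a).

Definition act (w : seq 'I_d) (x : 'I_n) : 'I_n := foldl (fun y a => c a y) x w.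

Lemma act_cat w1 w2 x : act (w1 ++ w2) x = act w2 (act w1 x).
Proof. exact: foldl_cat. Qed.

Lemma semigroup_gen_act X :
  semigroup_gen C X -> exists w, X = fun_mx R (act w).
Proof.
elim=> [a | Y Z _ [v ->] _ [w ->]]; first by exists [:: a].
by exists (v ++ w); rewrite fun_mxM; apply: eq_fun_mx => x; rewrite /= act_cat.
Qed.

Lemma ideal_act_mul (I : 'M[R]_n -> Prop) X w :
  semigroup_ideal (semigroup_gen C) I -> I X -> I (fun_mx R (act w) *m X).
Proof.
case=> _ _ idI IX; elim: w => [|a w IH] /=.
  by rewrite /fun_mx (@eq_rowsub _ _ _ _ _ id) ?mxsub_id ?mul1mx.
have [] := idI _ _ (semigroup_gen_base C a) IH.
by rewrite mulmxA CE fun_mxM.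
Qed.

(** An edge of the graph is a generator sending its source to its target. *)
Lemma irreducible_act (A : 'M[R]_n) (z : R) :
    A = z *: \sum_a C a -> irreducible_mx A ->
  forall x y, exists w, act w x = y.
Proof.
move=> AE irr x y; have [m [_ /lt0r_neq0]] := irr x y.
elim: m x => [|m IH] x.
  rewrite expr0 mxE; case: (x =P y) => [-> _ | _]; last by rewrite eqxx.
  by exists [::].
rewrite exprS => Axy.
have [j] : exists j, A x j * (A ^+ m) j y != 0.
  apply/existsP; apply: contraR Axy => /existsPn all0.
  by rewrite mxE big1 // => j _; apply/eqP; rewrite -[_ == _]negbK all0.
rewrite mulf_eq0 negb_or => /andP[Axj /IH[w <-]].
have [a /eqP <-] : exists a, c a x == j.
  apply/existsP; apply: contraR Axj => /existsPn no_edge.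
  rewrite AE mxE summxE big1 ?mulr0 // => a _.
  by rewrite CE fun_mxE (negPf (no_edge a)).
by exists (a :: w).
Qed.

(** The maximum principle applies to the mass of the fibre over [j0], as a
    function of the map [f \o act w]: prefixing a letter to [w] takes the
    preimage of that fibre under a generator. *)
Lemma invariant_fibre_mass (p : 'rV[R]_n) (f : 'I_n -> 'I_n) (j0 : 'I_n) :
    p *m \sum_a C a = d%:R *: p ->
  exists w0, forall w,
    (p *m fun_mx R (f \o act (w ++ w0))) 0 j0 =
    (p *m fun_mx R (f \o act w0)) 0 j0.
Proof.
move=> pinv.
pose step a (g : {ffun 'I_n -> 'I_n}) := [ffun x => g (c a x)].
pose phi (g : {ffun 'I_n -> 'I_n}) := (p *m fun_mx R g) 0 j0.
have phi_step g : \sum_a phi (step a g) = d%:R * phi g.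
  have -> : d%:R * phi g = (p *m (\sum_a C a) *m fun_mx R g) 0 j0.
    by rewrite pinv -scalemxAl [RHS]mxE.
  rewrite mulmx_sumr mulmx_suml summxE; apply: eq_bigr => a _.
  rewrite -mulmxA CE fun_mxM /phi.
  by rewrite (@eq_fun_mx _ _ (step a g) (g \o c a)) // => x; rewrite ffunE.
have foldr_step w :
    fun_mx R (foldr step (finfun f) w) = fun_mx R (f \o act w).
  apply: eq_fun_mx; elim: w => [|a w IH] x; first exact: ffunE.
  by rewrite /= ffunE IH.
have [w0 w0P] := maximum_principle (finfun f) phi_step.
by exists w0 => w; rewrite -!foldr_step; apply: w0P.
Qed.

(** Friedman's theorem.  With [w0] as in [invariant_fibre_mass], the set of
    vertices sent by [w0] into the fibre over [f x0] is the maximal preimage.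
    It is nonempty since [k m k] has the same image as [k]; the word [v] is [k]
    itself. *)
Lemma kernel_fibre_mass (p : 'rV[R]_n) (K : 'M[R]_n -> Prop)
    (r : nat) (k : 'M[R]_n) (f : 'I_n -> 'I_n) (x0 : 'I_n) :
    (forall x y, exists w, act w x = y) ->
    p *m \sum_a C a = d%:R *: p ->
    semigroup_ideal (semigroup_gen C) K -> common_rank K r ->
    K k -> k = fun_mx R f ->
  exists m, forall x, (p *m k) 0 (f x) = m.
Proof.
move=> conn pinv idK rankK Kk kE.
have [_ KS idKP] := idK.
have return_f w : #|(f \o act w \o f) @: 'I_n| = #|f @: 'I_n|.
  rewrite -!(rank_fun_mx R) -kE (rankK _ Kk).
  rewrite -(rankK (k *m (fun_mx R (act w) *m k))); first by rewrite kE !fun_mxM.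
  by have [] := idKP _ _ (KS _ Kk) (ideal_act_mul w idK Kk).
have [w0 w0P] := invariant_fibre_mass f (f x0) pinv.
exists ((p *m fun_mx R (f \o act w0)) 0 (f x0)) => x.
have [v vE] := semigroup_gen_act (KS _ Kk).
have fE y : f y = act v y.
  have /matrixP/(_ y (f y)) : fun_mx R f = fun_mx R (act v) by rewrite -kE.
  rewrite !fun_mxE eqxx; case: eqP => // _ /eqP.
  by rewrite oner_eq0.
have [_ /(_ x0)[y yE]] := card_imset_return (return_f w0).
have [w wE] := conn (f x) y.
rewrite -(w0P (v ++ w)) kE !mul_fun_mxE; apply: eq_bigl => z /=.
have [inj _] := card_imset_return (return_f (w ++ w0)).
rewrite !act_cat -fE; apply/eqP/eqP => [-> | fz]; first by rewrite wE.
by apply: inj; rewrite !act_cat fz wE.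
Qed.

End Words.

Theorem mainTheorem15 (R : realFieldType) (n d : nat) (hd : (0 < d)%N)
    (G : 'M[nat]_n) (hG : out_regular d G)
    (A : 'M[R]_n) (hA : A = d%:R^-1 *: adjacency R G)
    (hirr : irreducible_mx A) (haper : aperiodic_mx A)
    (pi : 'rV[R]_n) (hpi : invariant_distribution A pi)
    (C : 'I_d -> 'M[R]_n) (hC : forall i, binary_stochastic (C i))
    (hsum : adjacency R G = \sum_i C i)
    (K : 'M[R]_n -> Prop) (hK : minimal_ideal (semigroup_gen C) K)
    (r : nat) (hr : common_rank K r)
    (k : 'M[R]_n) (hk : K k) :
  pi *m k *m k^T = r%:R^-1 *: const_mx 1.
Proof.
have [c cE] := fin_all_exists (fun a => binary_stochastic_fun_mx (hC a)).
have [[_ KS _] _] := hK; have [_ pi1 piA] := hpi.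
have [f kE] : exists f, k = fun_mx R f.
  by have [w ->] := semigroup_gen_act cE (KS _ hk); exists (act c w).
rewrite hsum in hA.
have pinv : pi *m \sum_a C a = d%:R *: pi.
  by rewrite -{2}piA hA -scalemxAr scalerA mulfV ?scale1r // pnatr_eq0 -lt0n.
apply/rowP=> i.
have [m massE] := kernel_fibre_mass cE i (irreducible_act cE hA hirr) pinv hK.1
  hr hk kE.
rewrite {2}kE mul_fun_mx_trE massE !mxE mulr1.
(* The r fibres are disjoint and cover all the vertices. *)
have mass_total : r%:R * m = 1.
  rewrite -[RHS]pi1 (partition_big f (mem (f @: 'I_n))) /=; last first.
    by move=> x _; apply: imset_f.
  rewrite (eq_bigr (fun=> m)) => [|_ /imsetP[x _ ->]]; last first.
    by rewrite -(massE x) kE mul_fun_mxE.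
  by rewrite sumr_const -(hr _ hk) kE rank_fun_mx mulr_natl.
have r_neq0 : r%:R != 0 :> R.
  by apply: contra_eq_neq mass_total => ->; rewrite mul0r eq_sym oner_eq0.
by apply: (mulfI r_neq0); rewrite mass_total mulfV.
Qed.
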